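(* Let $G$ be a finitely generated LERF group with $\nabla G>0$. Then there exists a transitive right action of $G$ on a set $X$ such that: (1) only finitely many elements $g\in G$ act trivially on $X$; and (2) for every finitely generated subgroup $L$ of infinite index in $G$ and every $x\in X$, the orbit $xL$ is finite.
   Context: For a group $U$, $d(U)$ denotes the minimal cardinality of a generating set of $U$. The rank gradient of a finitely generated group $G$ is $\nabla G=\inf_U \frac{d(U)-1}{[G:U]}$, where $U$ ranges over all finite index subgroups of $G$. A group $G$ is LERF (subgroup separable) if every finitely generated subgroup of $G$ is the intersection of some collection of finite index subgroups of $G$. *)

(* Defs.v *)
From Stdlib Require Import Reals List.
Open Scope R_scope.

Record IsGroup (G : Type) (mul : G -> G -> G) (e : G) (inv : G -> G) : Prop := {
  grp_assoc : forall x y z, mul x (mul y z) = mul (mul x y) z;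
  grp_idl : forall x, mul e x = x;
  grp_idr : forall x, mul x e = x;
  grp_invl : forall x, mul (inv x) x = e;
  grp_invr : forall x, mul x (inv x) = e }.

Section GroupDefs.
Variables (G : Type) (mul : G -> G -> G) (e : G) (inv : G -> G).

Definition is_subgroup (H : G -> Prop) : Prop :=
  H e /\ (forall x y, H x -> H y -> H (mul x y)) /\ (forall x, H x -> H (inv x)).

Definition gen (S : G -> Prop) (x : G) : Prop :=
  forall H, is_subgroup H -> (forall y, S y -> H y) -> H x.

Definition generated_by_list (U : G -> Prop) (l : list G) : Prop :=
  NoDup l /\ (forall y, In y l -> U y) /\
  (forall x, U x <-> gen (fun y => In y l) x).

Definition fin_gen_subgroup (U : G -> Prop) : Prop :=
  is_subgroup U /\ exists l, generated_by_list U l.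

Definition fin_gen_group : Prop := exists l, generated_by_list (fun _ => True) l.

Definition min_gen_card (U : G -> Prop) (n : nat) : Prop :=
  (exists l, generated_by_list U l /\ length l = n) /\
  (forall l, generated_by_list U l -> (n <= length l)%nat).

(* [G : U] = n : the right cosets U g are represented by exactly n distinct
   representatives (U g = U t  iff  g t^-1 \in U). *)
Definition index_eq (U : G -> Prop) (n : nat) : Prop :=
  exists l : list G, length l = n /\
    (forall g, exists t, In t l /\ U (mul g (inv t))) /\
    (forall i j, (i < n)%nat -> (j < n)%nat ->
       U (mul (nth i l e) (inv (nth j l e))) -> i = j).

Definition finite_index_subgroup (U : G -> Prop) : Prop :=
  is_subgroup U /\ exists n, index_eq U n.

Definition LERF : Prop :=
  forall H, fin_gen_subgroup H ->
    forall x, H x <-> (forall K, finite_index_subgroup K ->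
                          (forall y, H y -> K y) -> K x).

Definition rank_gradient_values (r : R) : Prop :=
  exists U d n, finite_index_subgroup U /\ min_gen_card U d /\ index_eq U n /\
    r = (INR d - 1) / INR n.

Definition is_inf (P : R -> Prop) (r : R) : Prop :=
  (forall s, P s -> r <= s) /\ (forall r', (forall s, P s -> r' <= s) -> r' <= r).

Definition rank_gradient_is (r : R) : Prop := is_inf rank_gradient_values r.

Definition is_right_action (X : Type) (act : X -> G -> X) : Prop :=
  (forall x, act x e = x) /\ (forall x g h, act x (mul g h) = act (act x g) h).

Definition transitive_action (X : Type) (act : X -> G -> X) : Prop :=
  forall x y, exists g, act x g = y.

Definition finite_set {T : Type} (P : T -> Prop) : Prop :=
  exists l : list T, forall t, P t -> In t l.

End GroupDefs.

(* Main.v *)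
Require Import Defs.
From Stdlib Require Import Reals List Lia Lra Cantor FinFun Wf_nat.
From Stdlib Require Import Classical ClassicalEpsilon FunctionalExtensionality
  PropExtensionality ProofIrrelevance.
Open Scope R_scope.

(** Some [c > 0] satisfies [c [G:U] <= d(U)] for every [U] of finite index. Consequently,
    few generators cannot span a subgroup of finite but large index.

    Let [A], [B] be finitely generated of infinite index. By separability [B] lies in some
    [V] of finite index with [c [G:V] > d(B)], so the normal core [K] of [V] satisfies
    [d(B /\ K) < c [G:K]]. If [C <= K] is finitely generated of infinite index and
    [C <= U <= K] with [[K:U]] large, then by Schreier [<C, B /\ U>] has too few generators
    to be of finite index. Starting from [A /\ K] and adjoining in turn the conjugates of
    [B /\ K] by a transversal of [A] modulo [K], one obtains [U] of finite index such that
    [<A, B /\ U>] has infinite index.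

    If [A] contains a normal subgroup [M] of [G] with at least [m] elements, take [W] of
    finite index in some [U >= A] of large index, with [W] separating [m] elements of [M].
    Then [W] is generated by [W /\ A] and by lifts of generators of [M W], hence by about
    [d(G) [G:W] / m] elements, so [c m <= d(G)].

    One can therefore build an increasing chain of finitely generated subgroups of infinite
    index that absorbs a finite index part of every finitely generated subgroup of infinite
    index, while avoiding a conjugate of some element of every finite set with more than
    [d(G) / c] elements. The action is that of [G] on the right cosets of the union. *)

(** * Lists and enumerations *)

Lemma NoDup_map_inj (S T : Type) (f : S -> T) (l : list S) (x y : S) :
  NoDup (map f l) -> In x l -> In y l -> f x = f y -> x = y.
Proof.
  induction l as [|z l IH]; simpl; intros Hl Hx Hy Hxy; [destruct Hx|].
  apply NoDup_cons_iff in Hl as [Hz Hl].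
  destruct Hx as [->|Hx], Hy as [->|Hy]; auto; destruct Hz.
  - rewrite Hxy; now apply in_map.
  - rewrite <- Hxy; now apply in_map.
Qed.

Lemma NoDup_map_finer (S T U : Type) (f : S -> T) (g : S -> U) (l : list S) :
  (forall x y, In x l -> In y l -> g x = g y -> f x = f y) ->
  NoDup (map f l) -> NoDup (map g l).
Proof.
  intros Hfg Hl; apply Injective_map_NoDup_in; [|now apply NoDup_map_inv in Hl].
  intros x y Hx Hy Hxy; apply (NoDup_map_inj _ _ f l); auto.
Qed.

Lemma NoDup_list_prod (S T : Type) (l : list S) (l' : list T) :
  NoDup l -> NoDup l' -> NoDup (list_prod l l').
Proof.
  intros Hl Hl'; induction Hl as [|x l Hx Hl IH]; simpl; [constructor|].
  apply NoDup_app; auto.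
  - apply Injective_map_NoDup; auto. intros y z Hyz; now injection Hyz.
  - intros p Hp Hp'; apply in_map_iff in Hp as [y [<- _]].
    now apply in_prod_iff in Hp' as [Hx' _].
Qed.

Lemma finite_image_or_many (S T : Type) (f : S -> T) (P : S -> Prop) (n : nat) :
  (exists l, NoDup (map f l) /\ (forall x, In x l -> P x) /\
     (forall x, P x -> In (f x) (map f l))) \/
  (exists l, length l = n /\ NoDup (map f l) /\ (forall x, In x l -> P x)).
Proof.
  induction n as [|n [Hfin|[l [Hn [Hl HP]]]]].
  - right; exists nil; repeat split; [constructor|intros x []].
  - now left.
  - destruct (classic (forall x, P x -> In (f x) (map f l))) as [Hall|Hx].
    + left; now exists l.
    + apply not_all_ex_not in Hx as [x Hx]; apply imply_to_and in Hx as [Px Hx].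
      right; exists (x :: l); simpl; repeat split.
      * lia.
      * now constructor.
      * intros y [<-|Hy]; auto.
Qed.

Lemma finite_set_of_bounded_length (T : Type) (P : T -> Prop) (n : nat) :
  (forall l, NoDup l -> (forall x, In x l -> P x) -> length l <> n) -> finite_set P.
Proof.
  intros Hn; destruct (finite_image_or_many T T (fun x => x) P n) as [[l [_ [_ Hl]]]|Hmany].
  - exists l; intros x Px; specialize (Hl x Px); now rewrite map_id in Hl.
  - destruct Hmany as [l [Hlen [Hl HP]]]; rewrite map_id in Hl; now destruct (Hn l Hl HP).
Qed.

Fixpoint decode_list {T : Type} (f : nat -> T) (k m : nat) : list T :=
  match k with
  | O => nil
  | S k => let (a, b) := Cantor.of_nat m in f a :: decode_list f k b
  end.

Lemma decode_list_surjective (T : Type) (f : nat -> T) (l : list T) :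
  Surjective f -> exists m, decode_list f (length l) m = l.
Proof.
  intros Hf; induction l as [|x l [m Hm]]; simpl; [now exists O|].
  destruct (Hf x) as [a <-].
  exists (Cantor.to_nat (a, m)); now rewrite Cantor.cancel_of_to, Hm.
Qed.

Lemma list_enumerable (T : Type) :
  (exists f : nat -> T, Surjective f) -> exists f : nat -> list T, Surjective f.
Proof.
  intros [f Hf].
  exists (fun n => let (k, m) := Cantor.of_nat n in decode_list f k m); intros l.
  destruct (decode_list_surjective T f l Hf) as [m Hm].
  exists (Cantor.to_nat (length l, m)); now rewrite Cantor.cancel_of_to.
Qed.

(* The Rasiowa-Sikorski lemma *)
Lemma chain_meeting_dense_sets (T I : Type) (le : T -> T -> Prop) (D : I -> T -> Prop) :
  (forall x, le x x) -> (forall x y z, le x y -> le y z -> le x z) ->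
  (exists enum : nat -> I, Surjective enum) ->
  (forall i x, exists y, le x y /\ D i y) -> forall x0 : T,
  exists f : nat -> T, (forall n m, (n <= m)%nat -> le (f n) (f m)) /\
    forall i, exists n, D i (f n).
Proof.
  intros le_refl le_trans [enum Henum] dense x0.
  destruct (choice (fun (p : nat * T) y => le (snd p) y /\ D (enum (fst p)) y))
    as [next Hnext]; [intros p; apply dense|].
  set (f := fix f n := match n with O => x0 | S n => next (n, f n) end).
  exists f; split.
  - induction 1 as [|m _ IH]; auto.
    apply le_trans with (f m); auto. apply (Hnext (m, f m)).
  - intros i; destruct (Henum i) as [n <-]; exists (S n). apply (Hnext (n, f n)).
Qed.

(** * Subgroups and generators *)

Section Groups.

Context {G : Type} {mul : G -> G -> G} {e : G} {inv : G -> G}.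
Context (HG : IsGroup G mul e inv).

Local Notation "x ** y" := (mul x y) (at level 40, left associativity).
Local Notation "A ⊆ B" := (forall x, A x -> B x) (at level 70, no associativity).
Local Notation subgroup := (is_subgroup G mul e inv).
Local Notation gen := (gen G mul e inv).

Lemma mulA x y z : x ** (y ** z) = x ** y ** z. Proof. apply HG. Qed.
Lemma mul1l x : e ** x = x. Proof. apply HG. Qed.
Lemma mul1r x : x ** e = x. Proof. apply HG. Qed.
Lemma mulVl x : inv x ** x = e. Proof. apply HG. Qed.
Lemma mulVr x : x ** inv x = e. Proof. apply HG. Qed.
Lemma mulVK x y : x ** inv y ** y = x.
Proof. now rewrite <- mulA, mulVl, mul1r. Qed.
Lemma mulK x y : x ** y ** inv y = x.
Proof. now rewrite <- mulA, mulVr, mul1r. Qed.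

Lemma inv_unique x y : x ** y = e -> inv x = y.
Proof. intros Hxy. now rewrite <- (mul1r (inv x)), <- Hxy, mulA, mulVl, mul1l. Qed.

Lemma invM x y : inv (x ** y) = inv y ** inv x.
Proof. apply inv_unique. now rewrite mulA, mulK, mulVr. Qed.
Lemma invK x : inv (inv x) = x.
Proof. apply inv_unique, mulVl. Qed.
Lemma inv1 : inv e = e.
Proof. apply inv_unique, mul1l. Qed.

#[local] Hint Rewrite mulA mul1l mul1r mulVl mulVr mulVK mulK invM invK inv1 : group.
Ltac group_eq := autorewrite with group; reflexivity.

Lemma set_ext (A B : G -> Prop) : (forall x, A x <-> B x) -> A = B.
Proof.
  intros AB; apply functional_extensionality; intros x.
  now apply propositional_extensionality.
Qed.

Definition full : G -> Prop := fun _ => True.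
Definition inter (A B : G -> Prop) : G -> Prop := fun x => A x /\ B x.
Local Notation "A ∩ B" := (inter A B) (at level 40, left associativity).

Lemma subgroup_one H : subgroup H -> H e. Proof. intros sH; apply sH. Qed.
Lemma subgroup_mul H x y : subgroup H -> H x -> H y -> H (x ** y).
Proof. intros sH; apply sH. Qed.
Lemma subgroup_inv H x : subgroup H -> H x -> H (inv x).
Proof. intros sH; apply sH. Qed.

Lemma subgroup_div H x y : subgroup H -> H x -> H y -> H (x ** inv y).
Proof. intros sH Hx Hy; apply subgroup_mul; auto; now apply subgroup_inv. Qed.

Lemma subgroup_div_sym H x y : subgroup H -> H (x ** inv y) -> H (y ** inv x).
Proof.
  intros sH Hxy; replace (y ** inv x) with (inv (x ** inv y)) by group_eq.
  now apply subgroup_inv.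
Qed.

Lemma subgroup_full : subgroup full.
Proof. repeat split. Qed.

Lemma subgroup_inter H K : subgroup H -> subgroup K -> subgroup (H ∩ K).
Proof. unfold is_subgroup, inter; intuition auto. Qed.

Lemma gen_subgroup S : subgroup (gen S).
Proof.
  repeat split.
  - intros H sH _; apply sH.
  - intros x y Hx Hy H sH SH; apply sH; [now apply Hx|now apply Hy].
  - intros x Hx H sH SH; apply sH; now apply Hx.
Qed.

Lemma gen_incl (S : G -> Prop) : S ⊆ gen S.
Proof. intros x Hx H sH SH; auto. Qed.

Lemma gen_min (S H : G -> Prop) : subgroup H -> S ⊆ H -> gen S ⊆ H.
Proof. intros sH SH x Hx; now apply Hx. Qed.

Lemma gen_right_ind (S Q : G -> Prop) : Q e ->
  (forall x y, gen S x -> Q x -> S y -> Q (x ** y)) ->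
  (forall x y, gen S x -> Q x -> S y -> Q (x ** inv y)) -> gen S ⊆ Q.
Proof.
  intros Q1 QM QV x Hx.
  set (P := gen S ∩ Q).
  set (stable := fun z => forall y, P y -> P (y ** z)).
  assert (stable_x : stable x /\ stable (inv x)).
  { revert x Hx; apply (gen_min S (fun z => stable z /\ stable (inv z))).
    - split; [|split]; unfold stable.
      + rewrite inv1; split; intros y; now rewrite mul1r.
      + intros a b [Ha Ha'] [Hb Hb']; rewrite invM.
        split; intros y; rewrite mulA; auto.
      + intros a; rewrite invK; tauto.
    - intros z Hz; apply gen_incl in Hz as Gz; split; intros y [Gy Qy]; split; auto.
      + apply subgroup_mul; auto; apply gen_subgroup.
      + apply subgroup_div; auto; apply gen_subgroup. }
  rewrite <- (mul1l x); apply stable_x; split; auto; apply gen_subgroup.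
Qed.

Definition span (s : list G) : G -> Prop := gen (fun y => In y s).
Definition rank_le (H : G -> Prop) (d : nat) : Prop :=
  exists s, (length s <= d)%nat /\ H = span s.
Definition fin_gen (H : G -> Prop) : Prop := exists d, rank_le H d.
Definition join (A B : G -> Prop) : G -> Prop := gen (fun y => A y \/ B y).

Lemma rank_le_span s : rank_le (span s) (length s).
Proof. now exists s. Qed.

Lemma rank_le_is_subgroup H d : rank_le H d -> subgroup H.
Proof. intros [s [_ ->]]; apply gen_subgroup. Qed.

Lemma fin_gen_span s : fin_gen (span s).
Proof. exists (length s); apply rank_le_span. Qed.

Lemma fin_gen_is_subgroup H : fin_gen H -> subgroup H.
Proof. intros [d Hd]; now apply (rank_le_is_subgroup H d). Qed.

Lemma span_nil x : span nil x -> x = e.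
Proof.
  apply (gen_min _ (fun z => z = e)); [|intros z []].
  repeat split; intros; subst; auto using mul1l, inv1.
Qed.

Lemma join_incl_l A B : A ⊆ join A B.
Proof. intros x Hx; apply gen_incl; now left. Qed.

Lemma join_incl_r A B : B ⊆ join A B.
Proof. intros x Hx; apply gen_incl; now right. Qed.

Lemma join_min A B H : subgroup H -> A ⊆ H -> B ⊆ H -> join A B ⊆ H.
Proof. intros sH AH BH; apply gen_min; auto. intros y [Hy|Hy]; auto. Qed.

Lemma join_mono_r A B B' : B ⊆ B' -> join A B ⊆ join A B'.
Proof.
  intros BB; apply join_min; [apply gen_subgroup|apply join_incl_l|].
  intros x Hx; apply join_incl_r; auto.
Qed.

Lemma join_span s s' : join (span s) (span s') = span (s ++ s').
Proof.
  apply set_ext; intros x; split.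
  - apply join_min; [apply gen_subgroup| |]; apply gen_min; try apply gen_subgroup;
      intros y Hy; apply gen_incl, in_app_iff; auto.
  - apply gen_min; [apply gen_subgroup|]. intros y Hy; apply in_app_iff in Hy as [Hy|Hy].
    + now apply join_incl_l, gen_incl.
    + now apply join_incl_r, gen_incl.
Qed.

Lemma rank_le_join A B a b : rank_le A a -> rank_le B b -> rank_le (join A B) (a + b).
Proof.
  intros [s [Hs ->]] [s' [Hs' ->]]; exists (s ++ s'); split; [|apply join_span].
  rewrite length_app; lia.
Qed.

Lemma fin_gen_join A B : fin_gen A -> fin_gen B -> fin_gen (join A B).
Proof. intros [a Ha] [b Hb]; exists (a + b)%nat; now apply rank_le_join. Qed.

Lemma rank_le_generated_by_list U d : rank_le U d ->
  exists l, generated_by_list G mul e inv U l /\ (length l <= d)%nat.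
Proof.
  intros [s [Hs ->]].
  set (s' := nodup (fun x y => excluded_middle_informative (x = y)) s).
  assert (Hin : forall y, In y s' <-> In y s) by apply nodup_In.
  assert (s'_uniq : NoDup s') by apply NoDup_nodup.
  exists s'; split; [split; [auto|split]|].
  - intros y Hy; now apply gen_incl, Hin.
  - intros x; split; apply gen_min; try apply gen_subgroup;
      intros y Hy; now apply gen_incl, Hin.
  - apply Nat.le_trans with (length s); auto.
    apply NoDup_incl_length; auto. intros y; apply Hin.
Qed.

Lemma rank_le_min_gen_card U d : rank_le U d ->
  exists m, min_gen_card G mul e inv U m /\ (m <= d)%nat.
Proof.
  intros Hd; apply rank_le_generated_by_list in Hd as [l [Hl Hld]].
  destruct (dec_inh_nat_subset_has_unique_least_element
    (fun n => exists t, generated_by_list G mul e inv U t /\ length t = n))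
    as [m [[Hm m_min] _]].
  - intros n; apply classic.
  - now exists (length l), l.
  - exists m; split; [split; auto|].
    + intros t Ht; apply m_min; eauto.
    + apply Nat.le_trans with (length l); auto. apply m_min; eauto.
Qed.

Lemma generated_by_list_fin_gen U l : generated_by_list G mul e inv U l -> fin_gen U.
Proof.
  intros [_ [_ Ul]]; replace U with (span l); [apply fin_gen_span|].
  apply set_ext; intros x; now rewrite Ul.
Qed.

Lemma fin_gen_subgroup_iff H : fin_gen_subgroup G mul e inv H <-> fin_gen H.
Proof.
  split.
  - intros [_ [l Hl]]; now apply (generated_by_list_fin_gen H l).
  - intros fH; split; [now apply fin_gen_is_subgroup|]. destruct fH as [d Hd].
    apply rank_le_generated_by_list in Hd as [l [Hl _]]; now exists l.
Qed.

Lemma fin_gen_group_enumerable : fin_gen full -> exists f : nat -> G, Surjective f.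
Proof.
  intros [d [s [_ Hs]]].
  destruct (list_enumerable nat) as [words Hwords].
  { exists (fun n => n); intros n; now exists n. }
  set (letters := s ++ map inv s).
  set (value := fun w => fold_left mul (map (fun n => nth n letters e) w) e).
  assert (value_surj : Surjective value).
  { intros g; assert (Hg : span s g) by now rewrite <- Hs.
    assert (append_letter : forall x y, (exists w, value w = x) -> In y letters ->
              exists w, value w = x ** y).
    { intros x y [w <-] Hy; apply In_nth with (d := e) in Hy as [n [_ <-]].
      exists (w ++ n :: nil); unfold value; now rewrite map_app, fold_left_app. }
    revert g Hg; apply gen_right_ind.
    - now exists nil.
    - intros x y _ Hx Hy; apply append_letter; auto; apply in_app_iff; auto.
    - intros x y _ Hx Hy; apply append_letter; auto; apply in_app_iff; right.
      now apply in_map. }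
  exists (fun n => value (words n)); intros g.
  destruct (value_surj g) as [w <-]; destruct (Hwords w) as [n <-]; now exists n.
Qed.

(** * Conjugation and normal subgroups *)

Definition conjg (g x : G) : G := g ** x ** inv g.
Definition conj_set (g : G) (A : G -> Prop) : G -> Prop := fun x => A (conjg (inv g) x).
Definition normal (K : G -> Prop) : Prop := forall g x, K x -> K (conjg g x).
Definition core (U : G -> Prop) : G -> Prop := fun x => forall g, U (conjg g x).

Lemma conjgM g x y : conjg g (x ** y) = conjg g x ** conjg g y.
Proof. unfold conjg; group_eq. Qed.
Lemma conjgV g x : conjg g (inv x) = inv (conjg g x).
Proof. unfold conjg; group_eq. Qed.
Lemma conjg1 g : conjg g e = e.
Proof. unfold conjg; group_eq. Qed.
Lemma conjg_conjg g h x : conjg g (conjg h x) = conjg (g ** h) x.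
Proof. unfold conjg; group_eq. Qed.
Lemma conjgVK g x : conjg g (conjg (inv g) x) = x.
Proof. unfold conjg; group_eq. Qed.
Lemma conjgK g x : conjg (inv g) (conjg g x) = x.
Proof. unfold conjg; group_eq. Qed.

Lemma conj_set_conjg g A x : A x -> conj_set g A (conjg g x).
Proof. unfold conj_set; now rewrite conjgK. Qed.

Lemma conj_setK g A : conj_set (inv g) (conj_set g A) = A.
Proof. apply set_ext; intros x; unfold conj_set; now rewrite conjgVK. Qed.

Lemma conj_setVK g A : conj_set g (conj_set (inv g) A) = A.
Proof. rewrite <- (invK g) at 1; apply conj_setK. Qed.

Lemma conj_set_subgroup g H : subgroup H -> subgroup (conj_set g H).
Proof.
  unfold conj_set; intros sH; repeat split; intros.
  - rewrite conjg1; now apply subgroup_one.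
  - rewrite conjgM; now apply subgroup_mul.
  - rewrite conjgV; now apply subgroup_inv.
Qed.

Lemma span_map_conjg_incl g s : span (map (conjg g) s) ⊆ conj_set g (span s).
Proof.
  apply gen_min; [apply conj_set_subgroup, gen_subgroup|].
  intros y Hy; apply in_map_iff in Hy as [z [<- Hz]].
  now apply conj_set_conjg, gen_incl.
Qed.

Lemma conj_set_span g s : conj_set g (span s) = span (map (conjg g) s).
Proof.
  apply set_ext; intros x; split; [|apply span_map_conjg_incl].
  unfold conj_set; intros Hx.
  replace s with (map (conjg (inv g)) (map (conjg g) s)) in Hx.
  - apply span_map_conjg_incl in Hx; revert Hx; unfold conj_set.
    now rewrite invK, conjgVK.
  - rewrite map_map; erewrite map_ext by apply conjgK; apply map_id.
Qed.

Lemma rank_le_conj g H d : rank_le H d -> rank_le (conj_set g H) d.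
Proof.
  intros [s [Hs ->]]; exists (map (conjg g) s).
  rewrite length_map; split; [auto|apply conj_set_span].
Qed.

Lemma fin_gen_conj g H : fin_gen H -> fin_gen (conj_set g H).
Proof. intros [d Hd]; exists d; now apply rank_le_conj. Qed.

Lemma normal_conj_set_incl K g A : normal K -> A ⊆ K -> conj_set g A ⊆ K.
Proof. intros nK AK x Hx; rewrite <- (conjgVK g x); apply nK, AK, Hx. Qed.

Lemma core_subgroup U : subgroup U -> subgroup (core U).
Proof.
  intros sU; repeat split.
  - intros g; rewrite conjg1; now apply subgroup_one.
  - intros x y Hx Hy g; rewrite conjgM; apply subgroup_mul; auto.
  - intros x Hx g; rewrite conjgV; apply subgroup_inv; auto.
Qed.

Lemma core_incl U : core U ⊆ U.
Proof.
  intros x Hx; specialize (Hx e); revert Hx; unfold conjg; now autorewrite with group.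
Qed.

Lemma core_normal U : normal (core U).
Proof. intros g x Hx h; rewrite conjg_conjg; apply Hx. Qed.

Definition set_mul (A B : G -> Prop) : G -> Prop :=
  fun x => exists a b, A a /\ B b /\ x = a ** b.

Lemma set_mul_incl_l A B : B e -> A ⊆ set_mul A B.
Proof. intros Be x Ax; exists x, e; auto using mul1r. Qed.

Lemma set_mul_incl_r A B : A e -> B ⊆ set_mul A B.
Proof. intros Ae x Bx; exists e, x; auto using mul1l. Qed.

Lemma normal_set_mul_subgroup M W :
  subgroup M -> normal M -> subgroup W -> subgroup (set_mul M W).
Proof.
  intros sM nM sW; repeat split.
  - apply set_mul_incl_l; now apply subgroup_one.
  - intros x y [a [w [Ha [Hw ->]]]] [a' [w' [Ha' [Hw' ->]]]].
    exists (a ** conjg w a'), (w ** w'); split; [|split].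
    + apply subgroup_mul; auto.
    + now apply subgroup_mul.
    + unfold conjg; group_eq.
  - intros x [a [w [Ha [Hw ->]]]].
    exists (conjg (inv w) (inv a)), (inv w); split; [|split].
    + apply nM; now apply subgroup_inv.
    + now apply subgroup_inv.
    + unfold conjg; group_eq.
Qed.

(* Generators [w_i] of [W] modulo [M ∩ W] are lifted from generators [a_i w_i] of [M W]:
   the subgroup [M <w_i>] contains them all, hence contains [W]. *)
Lemma rank_le_of_normal_product M W A a n :
  subgroup M -> normal M -> subgroup W -> A ⊆ W -> M ∩ W ⊆ A ->
  rank_le A a -> rank_le (set_mul M W) n -> rank_le W (a + n).
Proof.
  intros sM nM sW AW MWA rA [s [Hs MWs]].
  destruct (choice (fun x w => In x s -> W w /\ exists m, M m /\ x = m ** w))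
    as [lift Hlift].
  { intros x; destruct (classic (In x s)) as [Hx|Hx]; [|exists e; tauto].
    assert (Px : set_mul M W x) by (rewrite MWs; now apply gen_incl).
    destruct Px as [m [w [Hm [Hw ->]]]]; exists w; eauto. }
  set (V := span (map lift s)).
  assert (VW : V ⊆ W).
  { apply gen_min; auto. intros w Hw; apply in_map_iff in Hw as [x [<- Hx]].
    now apply Hlift. }
  assert (MW_MV : set_mul M W ⊆ set_mul M V).
  { rewrite MWs; apply gen_min; [apply normal_set_mul_subgroup; auto; apply gen_subgroup|].
    intros x Hx; destruct (Hlift x Hx) as [_ [m [Hm Hxm]]].
    exists m, (lift x); repeat split; auto. now apply gen_incl, in_map. }
  replace W with (join A V).
  { apply rank_le_join; auto. exists (map lift s); now rewrite length_map. }
  apply set_ext; intros x; split; [now apply join_min|].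
  intros Wx; destruct (MW_MV x) as [m [v [Hm [Hv ->]]]].
  { apply set_mul_incl_r; auto; now apply subgroup_one. }
  apply subgroup_mul; [apply gen_subgroup| |now apply join_incl_r].
  apply join_incl_l, MWA; split; auto.
  rewrite <- (mulK m v); apply subgroup_div; auto.
Qed.

(** * Cosets and indices *)

Definition coset (U : G -> Prop) (g : G) : G -> Prop := fun x => U (x ** inv g).
Definition covers (H U : G -> Prop) (l : list G) : Prop :=
  forall h, H h -> exists t, In t l /\ coset U t h.
Definition cofinite (U : G -> Prop) : Prop := exists l, covers full U l.
Definition finite_index (U : G -> Prop) : Prop := subgroup U /\ cofinite U.

Definition transversal (H U : G -> Prop) (l : list G) : Prop :=
  (forall t, In t l -> H t) /\ NoDup (map (coset U) l) /\ covers H U l.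
(* [has_index H U n] says that [H ∩ U] has index [n] in [H]; [U] need not lie in [H]. *)
Definition has_index (H U : G -> Prop) (n : nat) : Prop :=
  exists l, length l = n /\ transversal H U l.

Lemma coset_eq U g h : subgroup U -> coset U g = coset U h <-> U (g ** inv h).
Proof.
  intros sU; split.
  - intros E; change (coset U h g); rewrite <- E; unfold coset.
    rewrite mulVr; now apply subgroup_one.
  - intros Hgh; apply set_ext; intros x; unfold coset; split; intros Hx.
    + replace (x ** inv h) with ((x ** inv g) ** (g ** inv h)) by group_eq.
      now apply subgroup_mul.
    + replace (x ** inv g) with ((x ** inv h) ** inv (g ** inv h)) by group_eq.
      now apply subgroup_div.
Qed.

Lemma coset_eq_mono U V g h : subgroup U -> subgroup V -> U ⊆ V ->
  coset U g = coset U h -> coset V g = coset V h.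
Proof. intros sU sV UV Hgh; apply coset_eq in Hgh; auto; apply coset_eq; auto. Qed.

Lemma covers_mono H H' U U' l : H' ⊆ H -> U ⊆ U' -> covers H U l -> covers H' U' l.
Proof.
  intros HH UU Hl h Hh; destruct (Hl h (HH h Hh)) as [t [Ht Ut]].
  exists t; split; [auto|now apply UU].
Qed.

Definition mul_list (l1 l2 : list G) : list G :=
  map (fun p => snd p ** fst p) (list_prod l1 l2).

Lemma length_mul_list l1 l2 : length (mul_list l1 l2) = (length l1 * length l2)%nat.
Proof. unfold mul_list; now rewrite length_map, length_prod. Qed.

Lemma covers_trans H K U l1 l2 :
  covers H K l1 -> covers K U l2 -> covers H U (mul_list l1 l2).
Proof.
  intros Hl1 Hl2 h Hh.
  destruct (Hl1 h Hh) as [a [Ha Ka]]; destruct (Hl2 _ Ka) as [t [Ht Ut]].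
  exists (t ** a); split.
  - apply in_map_iff; exists (a, t); split; auto. now apply in_prod.
  - revert Ut; unfold coset; now autorewrite with group.
Qed.

Lemma cofinite_mono U V : U ⊆ V -> cofinite U -> cofinite V.
Proof. intros UV [l Hl]; exists l; now apply (covers_mono full full U V). Qed.

Lemma cofinite_of_covers H U l : covers H U l -> cofinite H -> cofinite U.
Proof. intros Hl [l' Hl']; exists (mul_list l' l); now apply (covers_trans full H). Qed.

Lemma length_le_of_covers H U s l : subgroup U -> NoDup (map (coset U) s) ->
  (forall x, In x s -> H x) -> covers H U l -> (length s <= length l)%nat.
Proof.
  intros sU Hs sH Hl; rewrite <- (length_map (coset U) s), <- (length_map (coset U) l).
  apply NoDup_incl_length; auto. intros C HC; apply in_map_iff in HC as [x [<- Hx]].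
  destruct (Hl x (sH x Hx)) as [t [Ht Ut]].
  apply in_map_iff; exists t; split; auto. symmetry; now apply coset_eq.
Qed.

Lemma length_le_index H U s n : subgroup U -> NoDup (map (coset U) s) ->
  (forall x, In x s -> H x) -> has_index H U n -> (length s <= n)%nat.
Proof. intros sU Hs sH [l [<- [_ [_ Hl]]]]; now apply (length_le_of_covers H U). Qed.

Lemma transversal_or_many_cosets H U n : subgroup U ->
  (exists l, transversal H U l) \/
  (exists s, length s = n /\ NoDup (map (coset U) s) /\ forall x, In x s -> H x).
Proof.
  intros sU; destruct (finite_image_or_many G _ (coset U) H n) as [[l [Hl [lH Hcov]]]|Hmany].
  - left; exists l; split; [auto|split; auto]. intros h Hh.
    apply Hcov, in_map_iff in Hh as [t [E Ht]]; exists t; split; auto.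
    now apply (coset_eq U h t).
  - now right.
Qed.

Lemma covers_has_index H U l : subgroup U -> covers H U l -> exists n, has_index H U n.
Proof.
  intros sU Hl.
  destruct (transversal_or_many_cosets H U (S (length l)) sU) as [[t Ht]|[s [Hs [Us sH]]]].
  - now exists (length t), t.
  - pose proof (length_le_of_covers H U s l sU Us sH Hl); lia.
Qed.

Lemma finite_index_has_index H U : finite_index U -> exists n, has_index H U n.
Proof.
  intros [sU [l Hl]]; apply (covers_has_index H U l); auto.
  apply (covers_mono full H U U); auto. intros; exact I.
Qed.

Lemma has_index_le H H' U V m n : subgroup U -> subgroup V -> H' ⊆ H -> U ⊆ V ->
  has_index H' V m -> has_index H U n -> (m <= n)%nat.
Proof.
  intros sU sV HH UV [l [<- [lH [lV _]]]] iU.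
  apply (length_le_index H U); auto.
  revert lV; apply NoDup_map_finer; intros x y _ _; now apply coset_eq_mono.
Qed.

Lemma has_index_unique H U m n : subgroup U ->
  has_index H U m -> has_index H U n -> m = n.
Proof. intros sU Hm Hn; apply Nat.le_antisymm; eapply (has_index_le H H U U); eauto. Qed.

Lemma has_index_pos H U n : subgroup H -> has_index H U n -> (0 < n)%nat.
Proof.
  intros sH [l [<- [_ [_ Hl]]]]; destruct (Hl e) as [t [Ht _]]; [now apply subgroup_one|].
  destruct l; [destruct Ht|simpl; lia].
Qed.

Lemma has_index_mul H K U m n : subgroup H -> subgroup K -> subgroup U -> U ⊆ K -> K ⊆ H ->
  has_index H K m -> has_index K U n -> has_index H U (m * n).
Proof.
  intros sH sK sU UK KH [l1 [<- [l1H [l1K cov1]]]] [l2 [<- [l2K [l2U cov2]]]].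
  exists (mul_list l1 l2); split; [apply length_mul_list|split; [|split]].
  - intros x Hx; apply in_map_iff in Hx as [[a t] [<- Hat]].
    apply in_prod_iff in Hat as [Ha Ht]; simpl; apply subgroup_mul; auto.
  - unfold mul_list; rewrite map_map; apply Injective_map_NoDup_in.
    + intros [a t] [a' t'] Hat Hat'; simpl; intros E; apply coset_eq in E; auto.
      apply in_prod_iff in Hat as [Ha Ht], Hat' as [Ha' Ht'].
      assert (a = a') as <-.
      { apply (NoDup_map_inj _ _ (coset K) l1); auto; apply coset_eq; auto.
        replace (a ** inv a') with (inv t ** (t ** a ** inv (t' ** a')) ** t') by group_eq.
        apply subgroup_mul; auto; apply subgroup_mul; auto; apply subgroup_inv; auto. }
      f_equal; apply (NoDup_map_inj _ _ (coset U) l2); auto; apply coset_eq; auto.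
      revert E; now autorewrite with group.
    + apply NoDup_list_prod; [apply NoDup_map_inv in l1K|apply NoDup_map_inv in l2U]; auto.
  - now apply (covers_trans H K).
Qed.

Lemma has_index_full_index_eq U n : subgroup U -> has_index full U n ->
  index_eq G mul e inv U n.
Proof.
  intros sU [l [Hn [_ [lU Hl]]]]; exists l; repeat split; auto.
  - intros g; now apply Hl.
  - intros i j Hi Hj Hij; apply (proj1 (NoDup_nth (map (coset U) l) (coset U e)) lU);
      rewrite ?length_map, ?map_nth, ?Hn; auto.
    now apply coset_eq.
Qed.

Lemma cofinite_iff_index_eq U : subgroup U ->
  cofinite U <-> exists n, index_eq G mul e inv U n.
Proof.
  intros sU; split.
  - intros [l Hl]; destruct (covers_has_index full U l sU Hl) as [n Hn].
    exists n; now apply has_index_full_index_eq.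
  - intros [n [l [_ [Hl _]]]]; exists l; intros g _; apply Hl.
Qed.

Lemma finite_index_subgroup_iff U :
  finite_index_subgroup G mul e inv U <-> finite_index U.
Proof.
  split; intros [sU iU]; (split; [exact sU|]); now apply (cofinite_iff_index_eq U sU).
Qed.

Lemma finite_index_full : finite_index full.
Proof.
  split; [apply subgroup_full|]. exists (e :: nil); intros h _.
  exists e; split; [now left|exact I].
Qed.

Lemma finite_index_inter U V : finite_index U -> finite_index V -> finite_index (U ∩ V).
Proof.
  intros [sU cU] fV; split; [apply subgroup_inter; auto; apply fV|].
  destruct (finite_index_has_index U V fV) as [n [l [_ [lU [_ Hl]]]]].
  apply (cofinite_of_covers U (U ∩ V) l); auto.
  intros u Hu; destruct (Hl u Hu) as [t [Ht Vt]]; exists t; repeat split; auto.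
  apply subgroup_div; auto.
Qed.

Lemma finite_index_list_inter (S : Type) (F : S -> G -> Prop) (l : list S) :
  (forall a, In a l -> finite_index (F a)) ->
  finite_index (fun x => forall a, In a l -> F a x).
Proof.
  induction l as [|a l IH]; intros Fl.
  - replace (fun x => forall a, In a nil -> F a x) with full; [apply finite_index_full|].
    apply set_ext; intros x; split; [intros _ a []|intros; exact I].
  - replace (fun x => forall b, In b (a :: l) -> F b x)
      with (F a ∩ (fun x => forall b, In b l -> F b x)).
    + apply finite_index_inter; [apply Fl; now left|].
      apply IH; intros b Hb; apply Fl; now right.
    + apply set_ext; intros x; split.
      * intros [Fa Fx] b [<-|Hb]; auto.
      * intros Fx; split; [apply Fx; now left|intros b Hb; apply Fx; now right].
Qed.

Lemma cofinite_conj g U : cofinite U -> cofinite (conj_set g U).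
Proof.
  intros [l Hl]; exists (map (conjg g) l); intros h _.
  destruct (Hl (conjg (inv g) h) I) as [t [Ht Ut]].
  exists (conjg g t); split; [now apply in_map|].
  unfold coset, conj_set; now rewrite conjgM, conjgV, conjgK.
Qed.

Lemma infinite_index_conj g U : ~ cofinite U -> ~ cofinite (conj_set g U).
Proof.
  intros iU cU; apply iU; rewrite <- (conj_setK g U); now apply cofinite_conj.
Qed.

Lemma finite_index_conj g U : finite_index U -> finite_index (conj_set g U).
Proof. intros [sU cU]; split; [now apply conj_set_subgroup|now apply cofinite_conj]. Qed.

Lemma finite_index_core U : finite_index U -> finite_index (core U).
Proof.
  intros fU; pose proof fU as [sU [l Hl]]; split; [now apply core_subgroup|].
  destruct (finite_index_list_inter G (fun t => conj_set (inv t) U) l) as [_ cI].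
  { intros t _; now apply finite_index_conj. }
  revert cI; apply cofinite_mono; intros x Hx g; destruct (Hl g I) as [t [Ht Ut]].
  replace (conjg g x) with ((g ** inv t) ** conjg (inv (inv t)) x ** inv (g ** inv t))
    by (unfold conjg; group_eq).
  apply subgroup_div; auto. apply subgroup_mul; auto. apply (Hx t Ht).
Qed.

(** * The Schreier bound *)

Definition coset_rep (U : G -> Prop) (l : list G) (g : G) : G :=
  epsilon (inhabits e) (fun t => In t l /\ coset U g = coset U t).

Lemma coset_rep_spec H U l h : subgroup U -> covers H U l -> H h ->
  In (coset_rep U l h) l /\ U (h ** inv (coset_rep U l h)).
Proof.
  intros sU Hl Hh; rewrite <- (coset_eq U); auto; unfold coset_rep; apply epsilon_spec.
  destruct (Hl h Hh) as [t [Ht Ut]]; exists t; split; auto. now apply coset_eq.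
Qed.

Lemma coset_rep_eq U l g h : subgroup U -> U (g ** inv h) ->
  coset_rep U l g = coset_rep U l h.
Proof.
  intros sU Hgh; apply (coset_eq U) in Hgh; auto. unfold coset_rep; now rewrite Hgh.
Qed.

Definition schreier_generator (U : G -> Prop) (l : list G) (p : G * G) : G :=
  fst p ** snd p ** inv (coset_rep U l (fst p ** snd p)).
Definition schreier_generators (U : G -> Prop) (l s : list G) : list G :=
  map (schreier_generator U l) (list_prod l s).

Lemma schreier_generators_incl U l s : subgroup U -> transversal (span s) U l ->
  span (schreier_generators U l s) ⊆ span s ∩ U.
Proof.
  intros sU [lH [_ Hl]]; pose proof (gen_subgroup (fun y => In y s)) as sH.
  apply gen_min; [now apply subgroup_inter|].
  intros y Hy; apply in_map_iff in Hy as [[t a] [<- Hta]].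
  apply in_prod_iff in Hta as [Ht Ha]; unfold schreier_generator; simpl.
  assert (Hta : span s (t ** a)).
  { apply subgroup_mul; [exact sH|now apply lH|now apply gen_incl]. }
  destruct (coset_rep_spec _ U l _ sU Hl Hta) as [Hr Ur]; split; auto.
  apply subgroup_div; [exact sH|auto|now apply lH].
Qed.

Lemma schreier_rewriting U l s t x : subgroup U -> transversal (span s) U l ->
  In t l -> coset_rep U l t = t -> span s x ->
  span (schreier_generators U l s) (t ** x ** inv (coset_rep U l (t ** x))).
Proof.
  intros sU [lH [_ Hl]] Ht rep_t; revert x.
  pose proof (gen_subgroup (fun y => In y s)) as sH.
  pose proof (gen_subgroup (fun y => In y (schreier_generators U l s))) as sS.
  assert (generator : forall u a, In u l -> In a s ->
    span (schreier_generators U l s) (u ** a ** inv (coset_rep U l (u ** a)))).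
  { intros u a Hu Ha; apply gen_incl, in_map_iff; exists (u, a); split; auto.
    now apply in_prod. }
  assert (rep : forall x, span s x ->
    In (coset_rep U l (t ** x)) l /\ U (t ** x ** inv (coset_rep U l (t ** x)))).
  { intros x Hx; apply (coset_rep_spec (span s)); auto. apply subgroup_mul; auto. }
  apply gen_right_ind.
  - autorewrite with group; rewrite rep_t, mulVr; now apply subgroup_one.
  - intros x a Hx Sx Ha; destruct (rep x Hx) as [Hu Uu].
    set (u := coset_rep U l (t ** x)) in *.
    rewrite (coset_rep_eq U l (t ** (x ** a)) (u ** a)) by
      (auto; revert Uu; now autorewrite with group).
    replace (t ** (x ** a) ** inv (coset_rep U l (u ** a)))
      with ((t ** x ** inv u) ** (u ** a ** inv (coset_rep U l (u ** a)))) by group_eq.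
    apply subgroup_mul; auto.
  - intros x a Hx Sx Ha; set (u := coset_rep U l (t ** x)) in *.
    destruct (rep (x ** inv a)) as [Hv Uv].
    { apply subgroup_div; auto. now apply gen_incl. }
    set (v := coset_rep U l (t ** (x ** inv a))) in *.
    replace (t ** (x ** inv a) ** inv v) with ((t ** x ** inv u) ** inv (v ** a ** inv u))
      by group_eq.
    apply subgroup_div; auto.
    replace u with (coset_rep U l (v ** a)); [now apply generator|].
    apply coset_rep_eq; auto; apply subgroup_div_sym; auto.
    revert Uv; now autorewrite with group.
Qed.

(* Conjugating by the representative [t] of [U] itself avoids having to assume that the
   transversal contains [e]. *)
Lemma schreier_generators_span U l s : subgroup U -> transversal (span s) U l ->
  span s ∩ U = span (schreier_generators U l s).
Proof.
  intros sU T; apply set_ext; intros y.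
  split; [intros [Hy Uy]|now apply schreier_generators_incl].
  pose proof (gen_subgroup (fun y => In y s)) as sH.
  pose proof T as [lH [_ Hl]]; set (t := coset_rep U l e).
  destruct (coset_rep_spec _ U l e sU Hl) as [Ht Ut]; [now apply subgroup_one|].
  fold t in Ht, Ut.
  assert (rep_t : coset_rep U l t = t).
  { symmetry; now apply coset_rep_eq. }
  assert (Hx : span s (inv t ** y ** t)).
  { apply subgroup_mul; auto; apply subgroup_mul; auto; apply subgroup_inv; auto. }
  apply (schreier_rewriting U l s t) in Hx; auto.
  replace (t ** (inv t ** y ** t)) with (y ** t) in Hx by group_eq.
  rewrite (coset_rep_eq U l (y ** t) t), rep_t, mulK in Hx; auto. now rewrite mulK.
Qed.

Lemma rank_le_inter H U d n : subgroup U -> rank_le H d -> has_index H U n ->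
  rank_le (H ∩ U) (n * d).
Proof.
  intros sU [s [Hs ->]] [l [<- T]]; exists (schreier_generators U l s); split.
  - unfold schreier_generators; rewrite length_map, length_prod.
    now apply Nat.mul_le_mono_l.
  - now apply schreier_generators_span.
Qed.

Lemma fin_gen_inter H U : fin_gen H -> finite_index U -> fin_gen (H ∩ U).
Proof.
  intros [d Hd] fU; destruct (finite_index_has_index H U fU) as [n Hn].
  exists (n * d)%nat; apply rank_le_inter; auto; apply fU.
Qed.


(** * Rank growth and separability *)

Definition rank_growth (c : R) : Prop :=
  forall U d n, rank_le U d -> has_index full U n -> c * INR n <= INR d.

Lemma rank_gradient_growth r : rank_gradient_is G mul e inv r -> rank_growth r.
Proof.
  intros [Hr _] U d n rU iU; pose proof (rank_le_is_subgroup U d rU) as sU.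
  destruct (rank_le_min_gen_card U d rU) as [m [Hm Hmd]].
  apply has_index_pos in iU as n_pos; [|apply subgroup_full].
  apply has_index_full_index_eq in iU; auto.
  assert (Hrm : r <= (INR m - 1) / INR n).
  { apply Hr; exists U, m, n; repeat split; auto; try apply sU; try apply Hm.
    now exists n. }
  apply le_INR in Hmd; apply lt_0_INR in n_pos.
  apply (Rmult_le_compat_r (INR n)) in Hrm; [|lra].
  replace ((INR m - 1) / INR n * INR n) with (INR m - 1) in Hrm by (field; lra).
  lra.
Qed.

Lemma trivial_infinite_index c : 0 < c -> rank_growth c -> ~ cofinite (span nil).
Proof.
  intros c_pos growth [l Hl].
  destruct (covers_has_index full (span nil) l (gen_subgroup _) Hl) as [n Hn].
  pose proof (growth _ _ n (rank_le_span nil) Hn) as Hcn; simpl in Hcn.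
  apply has_index_pos, lt_0_INR in Hn; [nra|apply subgroup_full].
Qed.

Context (HLERF : LERF G mul e inv).

Lemma separate_from_list A F : fin_gen A ->
  exists U, finite_index U /\ A ⊆ U /\ forall x, In x F -> U x -> A x.
Proof.
  intros fA; induction F as [|x F [U [fU [AU UF]]]].
  - exists full; split; [apply finite_index_full|split; [intros; exact I|intros x []]].
  - destruct (classic (A x)) as [Ax|Ax].
    { exists U; repeat split; auto; try apply fU. intros y [<-|Hy]; auto. }
    assert (HK : exists K, finite_index K /\ A ⊆ K /\ ~ K x).
    { apply NNPP; intros noK; apply Ax.
      apply (HLERF A); [now apply fin_gen_subgroup_iff|].
      intros K fK AK; apply NNPP; intros Kx; apply noK; exists K.
      split; [now apply finite_index_subgroup_iff|auto]. }
    destruct HK as [K [fK [AK Kx]]]; exists (U ∩ K).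
    split; [now apply finite_index_inter|split; [now split; auto|]].
    intros y [<-|Hy] [Uy Ky]; [now destruct Kx|auto].
Qed.

Lemma separate_cosets A l : fin_gen A -> NoDup (map (coset A) l) ->
  exists U, finite_index U /\ A ⊆ U /\ NoDup (map (coset U) l).
Proof.
  intros fA Hl; set (F := map (fun p => fst p ** inv (snd p)) (list_prod l l)).
  destruct (separate_from_list A F fA) as [U [fU [AU UF]]].
  exists U; repeat (split; auto); try apply fU.
  revert Hl; apply NoDup_map_finer; intros x y Hx Hy Hxy.
  apply coset_eq in Hxy; [|apply fU]. apply coset_eq; [now apply fin_gen_is_subgroup|].
  apply UF; auto. apply in_map_iff; exists (x, y); split; auto. now apply in_prod.
Qed.

Lemma separate_points s : NoDup s -> exists U, finite_index U /\ NoDup (map (coset U) s).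
Proof.
  intros s_uniq.
  destruct (separate_cosets (span nil) s (fin_gen_span nil)) as [U [fU [_ Us]]];
    [|now exists U].
  rewrite <- map_id in s_uniq; revert s_uniq; apply NoDup_map_finer.
  intros x y _ _ Hxy; apply coset_eq in Hxy; [|apply gen_subgroup].
  apply span_nil in Hxy; now rewrite <- (mulVK x y), Hxy, mul1l.
Qed.

Lemma exists_overgroup_large_index H A n :
  finite_index H -> fin_gen A -> A ⊆ H -> ~ cofinite A ->
  exists U q, finite_index U /\ A ⊆ U /\ U ⊆ H /\ has_index H U q /\ (n <= q)%nat.
Proof.
  intros fH fA AH iA; pose proof (fin_gen_is_subgroup A fA) as sA.
  destruct (transversal_or_many_cosets H A n sA) as [[l [_ [_ Hl]]]|[s [<- [As sH]]]].
  - destruct iA; apply (cofinite_of_covers H A l); auto. apply fH.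
  - destruct (separate_cosets A s fA As) as [U [fU [AU Us]]].
    assert (fUH : finite_index (U ∩ H)) by now apply finite_index_inter.
    destruct (finite_index_has_index H (U ∩ H) fUH) as [q Hq].
    exists (U ∩ H), q; split; [auto|split; [now split; auto|]].
    split; [now intros x []|split; auto].
    apply (length_le_index H (U ∩ H)); auto; [apply fUH|].
    revert Us; apply NoDup_map_finer; intros x y _ _.
    apply coset_eq_mono; [apply fUH|apply fU|now intros z []].
Qed.

(** * Adjoining a finite index part *)

Context (c : R) (c_pos : 0 < c) (growth : rank_growth c).

Lemma join_infinite_index K k B b C :
  finite_index K -> has_index full K k -> rank_le B b -> B ⊆ K -> INR b < c * INR k ->
  fin_gen C -> C ⊆ K -> ~ cofinite C ->
  exists U, finite_index U /\ ~ cofinite (join C (B ∩ U)).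
Proof.
  intros fK iK rB BK Hb fC CK iC; pose proof fC as [a rC].
  destruct (INR_archimed (c * INR k - INR b) (INR a)) as [n Hn]; [lra|].
  destruct (exists_overgroup_large_index K C n fK fC CK iC)
    as [U [q [fU [CU [UK [iU Hnq]]]]]].
  pose proof (proj1 fU) as sU.
  exists U; split; auto; intros cJ.
  destruct (finite_index_has_index B U fU) as [p Hp].
  assert (Hpq : (p <= q)%nat) by now apply (has_index_le K B U U).
  set (J := join C (B ∩ U)) in *.
  assert (rJ : rank_le J (a + p * b)) by (apply rank_le_join; auto; now apply rank_le_inter).
  assert (sJ : subgroup J) by apply gen_subgroup.
  assert (JU : J ⊆ U) by (apply join_min; auto; now intros x []).
  destruct (finite_index_has_index full J (conj sJ cJ)) as [j Hj].
  assert (Hkqj : (k * q <= j)%nat).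
  { apply (has_index_le full full J U); auto.
    apply (has_index_mul full K U); auto; [apply subgroup_full|apply fK|intros; exact I]. }
  pose proof (growth J _ j rJ Hj) as HJ.
  rewrite plus_INR, mult_INR in HJ.
  apply le_INR in Hnq, Hpq, Hkqj; rewrite mult_INR in Hkqj.
  assert (Hpb : INR p * INR b <= INR q * INR b) by (pose proof (pos_INR b); nra).
  assert (Hq : INR q * (c * INR k - INR b) <= INR a) by nra.
  nra.
Qed.

Lemma join_conjugates_infinite_index K k B b C ts :
  finite_index K -> normal K -> has_index full K k ->
  rank_le B b -> B ⊆ K -> INR b < c * INR k ->
  fin_gen C -> C ⊆ K -> ~ cofinite C ->
  exists D U, (fin_gen D /\ D ⊆ K /\ ~ cofinite D) /\ C ⊆ D /\ finite_index U /\
    forall t, In t ts -> conj_set t (B ∩ U) ⊆ D.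
Proof.
  intros fK nK iK rB BK Hb fC CK iC; induction ts as [|t ts IH].
  - exists C, full; repeat (split; auto); try apply finite_index_full. intros t [].
  - destruct IH as [D [U [[fD [DK iD]] [CD [fU HU]]]]].
    set (Bt := conj_set t B).
    assert (BtK : Bt ⊆ K) by now apply normal_conj_set_incl.
    destruct (join_infinite_index K k Bt b D) as [V [fV iV]]; auto.
    { now apply rank_le_conj. }
    assert (fBt : fin_gen Bt) by (exists b; now apply rank_le_conj).
    exists (join D (Bt ∩ V)), (U ∩ conj_set (inv t) V).
    split; [split; [|split; [|auto]]|split; [|split]].
    + apply fin_gen_join; auto; now apply fin_gen_inter.
    + apply join_min; [apply fK|auto|]. intros x [Hx _]; auto.
    + intros x Hx; apply join_incl_l; auto.
    + apply finite_index_inter; auto; now apply finite_index_conj.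
    + intros t' [<-|Ht'] x [Bx [Ux Vx]].
      * apply join_incl_r; split; auto.
        change (conj_set t (conj_set (inv t) V) x) in Vx; now rewrite conj_setVK in Vx.
      * apply join_incl_l, (HU t' Ht'); now split.
Qed.

Lemma exists_normal_small_rank B : fin_gen B -> ~ cofinite B ->
  exists K k b, finite_index K /\ normal K /\ has_index full K k /\
    rank_le (B ∩ K) b /\ INR b < c * INR k.
Proof.
  intros fB iB; pose proof fB as [b rB].
  destruct (INR_archimed c (INR b)) as [n Hn]; [lra|].
  destruct (exists_overgroup_large_index full B n finite_index_full fB)
    as [V [v [fV [BV [_ [iV Hnv]]]]]]; [intros; exact I|auto|].
  set (K := core V).
  assert (fK : finite_index K) by now apply finite_index_core.
  pose proof (proj1 fV) as sV; pose proof (proj1 fK) as sK.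
  destruct (finite_index_has_index V K fK) as [w Hw].
  destruct (finite_index_has_index B K fK) as [p Hp].
  assert (Hpw : (p <= w)%nat) by now apply (has_index_le V B K K).
  exists K, (v * w)%nat, (p * b)%nat; repeat split; try apply fK.
  - apply core_normal.
  - apply (has_index_mul full V K); auto;
      [apply subgroup_full|apply core_incl|intros; exact I].
  - now apply rank_le_inter.
  - apply has_index_pos, lt_0_INR in Hw; auto; apply le_INR in Hnv, Hpw.
    rewrite !mult_INR; pose proof (pos_INR b).
    assert (Hbv : INR b < c * INR v) by nra.
    apply Rle_lt_trans with (INR w * INR b); [nra|].
    replace (c * (INR v * INR w)) with (INR w * (c * INR v)) by ring.
    now apply Rmult_lt_compat_l.
Qed.

(* [⋃ D t] is stable under right multiplication by [A] and by [E]. *)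
Lemma covers_join A E D K ts : subgroup A -> subgroup E -> subgroup D ->
  (forall t, In t ts -> A t) -> covers A K ts ->
  A ∩ K ⊆ D -> (forall t, In t ts -> conj_set t E ⊆ D) ->
  covers (join A E) D ts.
Proof.
  intros sA sE sD tsA Hts AKD ED.
  set (DT := fun x => exists t, In t ts /\ coset D t x).
  assert (stable_A : forall x y, DT x -> A y -> DT (x ** y)).
  { intros x y [t [Ht Dt]] Ay.
    assert (Aty : A (t ** y)) by (apply subgroup_mul; auto).
    destruct (Hts _ Aty) as [t' [Ht' Kt']]; exists t'; split; auto; unfold coset in *.
    replace (x ** y ** inv t') with ((x ** inv t) ** (t ** y ** inv t')) by group_eq.
    apply subgroup_mul; auto; apply AKD; split; auto. apply subgroup_div; auto. }
  assert (stable_E : forall x y, DT x -> E y -> DT (x ** y)).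
  { intros x y [t [Ht Dt]] Ey; exists t; split; auto; unfold coset in *.
    replace (x ** y ** inv t) with ((x ** inv t) ** conjg t y) by (unfold conjg; group_eq).
    apply subgroup_mul; auto; apply (ED t Ht); now apply conj_set_conjg. }
  change (join A E ⊆ DT); apply gen_right_ind.
  - destruct (Hts e (subgroup_one A sA)) as [t [Ht Kt]]; exists t; split; auto.
    apply AKD; split; auto. apply subgroup_div; auto; now apply subgroup_one.
  - intros x y _ Hx [Ay|Ey]; [now apply stable_A|now apply stable_E].
  - intros x y _ Hx [Ay|Ey]; [apply stable_A|apply stable_E]; auto; now apply subgroup_inv.
Qed.

Lemma join_finite_index_part_infinite_index A B :
  fin_gen A -> ~ cofinite A -> fin_gen B -> ~ cofinite B ->
  exists U, finite_index U /\ ~ cofinite (join A (B ∩ U)).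
Proof.
  intros fA iA fB iB.
  destruct (exists_normal_small_rank B fB iB) as [K [k [b [fK [nK [iK [rBK Hb]]]]]]].
  destruct (finite_index_has_index A K fK) as [_ [ts [_ [tsA [_ Hts]]]]].
  destruct (join_conjugates_infinite_index K k (B ∩ K) b (A ∩ K) ts)
    as [D [U [[fD [_ iD]] [AKD [fU HU]]]]]; auto.
  - now intros x [].
  - now apply fin_gen_inter.
  - now intros x [].
  - intros cAK; apply iA; revert cAK; apply cofinite_mono; now intros x [].
  - assert (fKU : finite_index (K ∩ U)) by now apply finite_index_inter.
    exists (K ∩ U); split; auto; intros cJ; apply iD.
    revert cJ; apply (cofinite_of_covers _ _ ts), (covers_join A _ D K); auto.
    + now apply fin_gen_is_subgroup.
    + apply subgroup_inter; [now apply fin_gen_is_subgroup|apply fKU].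
    + now apply fin_gen_is_subgroup.
    + intros t Ht x [Bx [Kx Ux]]; apply (HU t Ht); repeat split; auto.
Qed.

(** * Normal subgroups inside subgroups of infinite index *)

Lemma rank_le_of_normal_subgroup M A W d a p q :
  subgroup M -> normal M -> M ⊆ A -> subgroup W ->
  rank_le A a -> has_index A W q -> rank_le full d -> has_index full (set_mul M W) p ->
  rank_le W (q * a + p * d).
Proof.
  intros sM nM MA sW rA iA rG iP.
  apply (rank_le_of_normal_product M W (A ∩ W)); auto.
  - now intros x [].
  - intros x [Mx Wx]; split; auto.
  - now apply rank_le_inter.
  - replace (set_mul M W) with (full ∩ set_mul M W).
    + apply rank_le_inter; auto. now apply normal_set_mul_subgroup.
    + apply set_ext; intros x; split; [now intros []|now split].
Qed.

Lemma index_set_mul_le M W s p n : subgroup M -> normal M -> finite_index W ->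
  NoDup (map (coset W) s) -> (forall x, In x s -> M x) ->
  has_index full (set_mul M W) p -> has_index full W n -> (p * length s <= n)%nat.
Proof.
  intros sM nM fW Ws Ms iP iW; pose proof (proj1 fW) as sW.
  set (P := set_mul M W) in *.
  assert (sP : subgroup P) by now apply normal_set_mul_subgroup.
  destruct (finite_index_has_index P W fW) as [r Hr].
  assert (Hsr : (length s <= r)%nat).
  { apply (length_le_index P W); auto. intros x Hx.
    apply set_mul_incl_l; auto. now apply subgroup_one. }
  assert (Hpr : has_index full W (p * r)).
  { apply (has_index_mul full P W); auto; [apply subgroup_full| |intros; exact I].
    now apply set_mul_incl_r, subgroup_one. }
  rewrite (has_index_unique full W n (p * r)); auto.
  now apply Nat.mul_le_mono_l.
Qed.

Lemma overgroup_index_bounded M A U s a d u : subgroup M -> normal M -> M ⊆ A -> A ⊆ U ->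
  finite_index U -> rank_le A a -> rank_le full d -> has_index full U u ->
  NoDup s -> (forall x, In x s -> M x) ->
  INR u * (c * INR (length s) - INR d) <= INR a * INR (length s).
Proof.
  intros sM nM MA AU fU rA rG iU s_uniq Ms; set (m := length s).
  destruct (separate_points s s_uniq) as [W' [fW' W's]]; pose proof (proj1 fU) as sU.
  set (W := U ∩ W').
  assert (fW : finite_index W) by now apply finite_index_inter.
  pose proof (proj1 fW) as sW.
  assert (Ws : NoDup (map (coset W) s)).
  { revert W's; apply NoDup_map_finer; intros x y _ _.
    apply coset_eq_mono; [auto|apply fW'|now intros z []]. }
  assert (fP : finite_index (set_mul M W)).
  { split; [now apply normal_set_mul_subgroup|].
    apply (cofinite_mono W); [now apply set_mul_incl_r, subgroup_one|apply fW]. }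
  destruct (finite_index_has_index U W fW) as [q Hq].
  destruct (finite_index_has_index A W fW) as [q' Hq'].
  destruct (finite_index_has_index full _ fP) as [p Hp].
  assert (Huq : has_index full W (u * q)).
  { apply (has_index_mul full U W); auto;
      [apply subgroup_full|now intros x []|intros; exact I]. }
  assert (Hqq : (q' <= q)%nat) by now apply (has_index_le U A W W).
  assert (Hpm : (p * m <= u * q)%nat) by now apply (index_set_mul_le M W s).
  assert (rW : rank_le W (q' * a + p * d)) by now apply (rank_le_of_normal_subgroup M A).
  pose proof (growth W _ _ rW Huq) as HW.
  apply has_index_pos, lt_0_INR in Hq; auto. apply le_INR in Hqq, Hpm.
  rewrite plus_INR, !mult_INR in HW; rewrite !mult_INR in Hpm.
  pose proof (pos_INR a); pose proof (pos_INR d); pose proof (pos_INR m).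
  apply (Rmult_le_compat_r (INR m)) in HW; auto.
  apply (Rmult_le_compat_r (INR d)) in Hpm; auto.
  apply (Rmult_le_compat_r (INR a * INR m)) in Hqq; [|nra].
  apply (Rmult_le_reg_l (INR q)); lra.
Qed.

Lemma normal_subgroup_bounded M A s d :
  subgroup M -> normal M -> M ⊆ A -> fin_gen A -> ~ cofinite A -> rank_le full d ->
  NoDup s -> (forall x, In x s -> M x) -> c * INR (length s) <= INR d.
Proof.
  intros sM nM MA fA iA rG s_uniq Ms; pose proof fA as [a rA].
  apply Rnot_lt_le; intros Hlt.
  destruct (INR_archimed (c * INR (length s) - INR d) (INR a * INR (length s)))
    as [n Hn]; [lra|].
  destruct (exists_overgroup_large_index full A n finite_index_full fA)
    as [U [u [fU [AU [_ [iU Hnu]]]]]]; [intros; exact I|auto|].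
  pose proof (overgroup_index_bounded M A U s a d u sM nM MA AU fU rA rG iU s_uniq Ms).
  apply le_INR in Hnu; nra.
Qed.

(** * The absorbing subgroup *)

Definition virtually_contained (B A : G -> Prop) : Prop :=
  exists U, finite_index U /\ B ∩ U ⊆ A.

Lemma virtually_contained_mono B A A' :
  A ⊆ A' -> virtually_contained B A -> virtually_contained B A'.
Proof. intros AA [U [fU HU]]; exists U; auto. Qed.

Lemma virtually_contained_covers B H : subgroup B -> virtually_contained B H ->
  exists l, covers B H l.
Proof.
  intros sB [U [fU HU]].
  destruct (finite_index_has_index B U fU) as [_ [l [_ [lB [_ Hl]]]]].
  exists l; intros b Hb; destruct (Hl b Hb) as [t [Ht Ut]]; exists t; split; auto.
  apply HU; split; auto. apply subgroup_div; auto.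
Qed.

(* A stage of the chain; the elements of [avoided] are barred from all later stages too. *)
Record condition : Type := Condition {
  carrier : G -> Prop;
  avoided : list G;
  carrier_fin_gen : fin_gen carrier;
  carrier_infinite_index : ~ cofinite carrier;
  carrier_avoids : forall x, In x avoided -> ~ carrier x }.

Definition extends (p q : condition) : Prop :=
  carrier p ⊆ carrier q /\ incl (avoided p) (avoided q).

Lemma extends_refl p : extends p p.
Proof. split; auto using incl_refl. Qed.

Lemma extends_trans p q r : extends p q -> extends q r -> extends p r.
Proof. intros [pq pq'] [qr qr']; split; eauto using incl_tran. Qed.

Definition initial_condition : condition :=
  Condition (span nil) nil (fin_gen_span nil) (trivial_infinite_index c c_pos growth)
    (fun x Hx => False_ind _ Hx).

Definition excludes (s : list G) (p : condition) : Prop :=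
  exists g x, In x s /\ In (conjg g x) (avoided p).

Lemma excludes_dense s d p : rank_le full d -> NoDup s -> INR d < c * INR (length s) ->
  exists q, extends p q /\ excludes s q.
Proof.
  intros rG s_uniq Hlt; destruct p as [A F fA iA FA].
  destruct (classic (forall x, In x s -> core A x)) as [Hs|Hs].
  - pose proof (fin_gen_is_subgroup A fA) as sA.
    pose proof (normal_subgroup_bounded (core A) A s d (core_subgroup A sA) (core_normal A)
                  (core_incl A) fA iA rG s_uniq Hs); lra.
  - apply not_all_ex_not in Hs as [x Hs]; apply imply_to_and in Hs as [Hx Hs].
    apply not_all_ex_not in Hs as [g Hgx].
    assert (FA' : forall y, In y (conjg g x :: F) -> ~ A y) by (intros y [<-|Hy]; auto).
    exists (Condition A (conjg g x :: F) fA iA FA'); split.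
    + split; simpl; auto. now apply incl_tl, incl_refl.
    + exists g, x; simpl; auto.
Qed.

Lemma absorbs_dense B p : fin_gen B -> ~ cofinite B ->
  exists q, extends p q /\ virtually_contained B (carrier q).
Proof.
  intros fB iB; destruct p as [A F fA iA FA].
  destruct (join_finite_index_part_infinite_index A B fA iA fB iB) as [U [fU iU]].
  destruct (separate_from_list A F fA) as [V [fV [AV VF]]].
  assert (fUV : finite_index (U ∩ V)) by now apply finite_index_inter.
  set (J := join A (B ∩ (U ∩ V))).
  assert (fJ : fin_gen J) by (apply fin_gen_join; auto; now apply fin_gen_inter).
  assert (iJ : ~ cofinite J).
  { intros cJ; apply iU; revert cJ; apply cofinite_mono, join_mono_r.
    intros x [Bx [Ux _]]; now split. }
  assert (JV : J ⊆ V) by (apply join_min; [apply fV|auto|now intros x [_ []]]).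
  assert (FJ : forall x, In x F -> ~ J x) by (intros x Hx Jx; apply (FA x Hx), VF; auto).
  exists (Condition J F fJ iJ FJ); split.
  - split; simpl; [apply join_incl_l|apply incl_refl].
  - exists (U ∩ V); split; auto. apply join_incl_r.
Qed.

(* The list [s] encodes two requests: to absorb a finite index part of [span s], and to keep
   [s], if long enough, from being contained in the core. *)
Definition meets_request (d : nat) (s : list G) (p : condition) : Prop :=
  (~ cofinite (span s) -> virtually_contained (span s) (carrier p)) /\
  (NoDup s -> INR d < c * INR (length s) -> excludes s p).

Lemma meets_request_dense d s p : rank_le full d ->
  exists q, extends p q /\ meets_request d s q.
Proof.
  intros rG.
  assert (Hq : exists q, extends p q /\
            (NoDup s -> INR d < c * INR (length s) -> excludes s q)).
  { destruct (classic (NoDup s /\ INR d < c * INR (length s))) as [[Hs Hlt]|Hs].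
    - destruct (excludes_dense s d p rG Hs Hlt) as [q [pq Hq]]; exists q; auto.
    - exists p; split; [apply extends_refl|tauto]. }
  destruct Hq as [q [pq Hq]].
  destruct (classic (cofinite (span s))) as [cs|is].
  - exists q; split; [auto|split; [tauto|auto]].
  - destruct (absorbs_dense (span s) q (fin_gen_span s) is) as [r [qr Hr]].
    exists r; split; [now apply (extends_trans p q)|split; [auto|]].
    intros Hs Hlt; destruct (Hq Hs Hlt) as [g [x [Hx Hgx]]]; exists g, x.
    split; [auto|now apply qr].
Qed.

Lemma chain_union_subgroup (A : nat -> G -> Prop) :
  (forall n, subgroup (A n)) -> (forall n m, (n <= m)%nat -> A n ⊆ A m) ->
  subgroup (fun x => exists n, A n x).
Proof.
  intros sA A_mono; repeat split.
  - exists O; now apply subgroup_one.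
  - intros x y [n Hn] [m Hm]; exists (max n m).
    apply subgroup_mul; [auto|apply (A_mono n)|apply (A_mono m)]; auto; lia.
  - intros x [n Hn]; exists n; now apply subgroup_inv.
Qed.

Lemma exists_absorbing_subgroup : fin_gen full ->
  exists H, subgroup H /\ finite_set (core H) /\
    forall L, fin_gen L -> ~ cofinite L -> virtually_contained L H.
Proof.
  intros fG; pose proof fG as [d rG].
  destruct (chain_meeting_dense_sets condition (list G) extends (meets_request d)
    extends_refl extends_trans (list_enumerable G (fin_gen_group_enumerable fG))
    (fun s q => meets_request_dense d s q rG) initial_condition)
    as [p [p_mono p_meets]].
  exists (fun x => exists n, carrier (p n) x); split; [|split].
  - apply chain_union_subgroup; [|intros n m Hnm; now apply p_mono].
    intros n; apply fin_gen_is_subgroup, carrier_fin_gen.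
  - destruct (INR_archimed c (INR d) c_pos) as [n Hn].
    apply (finite_set_of_bounded_length G _ n); intros s s_uniq Hs <-.
    destruct (p_meets s) as [k [_ Hk]].
    destruct Hk as [g [x [Hx Hgx]]]; [auto|lra|].
    destruct (Hs x Hx g) as [m Hm].
    apply (carrier_avoids (p (max k m)) (conjg g x)).
    + apply (p_mono k); [lia|auto].
    + apply (p_mono m); [lia|auto].
  - intros L [b [s [_ ->]]] iL; destruct (p_meets s) as [n [Hn _]].
    apply (virtually_contained_mono _ (carrier (p n))); auto. intros x Hx; now exists n.
Qed.

(** * The action on right cosets *)

Definition coset_space (H : G -> Prop) : Type := {C : G -> Prop | exists g, C = coset H g}.

Lemma coset_translate H g h : (fun x => coset H g (x ** inv h)) = coset H (g ** h).
Proof. apply set_ext; intros x; unfold coset; now autorewrite with group. Qed.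

Lemma is_coset_translate H (C : coset_space H) (h : G) :
  exists g, (fun x => proj1_sig C (x ** inv h)) = coset H g.
Proof. destruct C as [C [g ->]]; exists (g ** h); apply coset_translate. Qed.

Definition coset_action (H : G -> Prop) (C : coset_space H) (h : G) : coset_space H :=
  exist _ (fun x => proj1_sig C (x ** inv h)) (is_coset_translate H C h).

Definition coset_point (H : G -> Prop) (g : G) : coset_space H :=
  exist _ (coset H g) (ex_intro _ g eq_refl).

Lemma coset_point_surj H (C : coset_space H) : exists g, C = coset_point H g.
Proof. destruct C as [C [g Hg]]; exists g; now apply subset_eq_compat. Qed.

Lemma coset_point_eq H g h : subgroup H ->
  coset_point H g = coset_point H h <-> H (g ** inv h).
Proof.
  intros sH; rewrite <- coset_eq; auto; split; intros E; [now injection E|].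
  now apply subset_eq_compat.
Qed.

Lemma coset_action_point H g h : coset_action H (coset_point H g) h = coset_point H (g ** h).
Proof. apply subset_eq_compat, coset_translate. Qed.

Lemma coset_action_is_right_action H : is_right_action G mul e (coset_space H) (coset_action H).
Proof.
  split; [intros C|intros C g h]; destruct (coset_point_surj H C) as [k ->];
    rewrite !coset_action_point; now autorewrite with group.
Qed.

Lemma coset_action_transitive H : transitive_action G (coset_space H) (coset_action H).
Proof.
  intros C D; destruct (coset_point_surj H C) as [g ->], (coset_point_surj H D) as [h ->].
  exists (inv g ** h); rewrite coset_action_point; now autorewrite with group.
Qed.

Lemma coset_action_kernel H g : subgroup H ->
  (forall C, coset_action H C g = C) -> core H g.
Proof.
  intros sH Hg h; specialize (Hg (coset_point H h)).
  now rewrite coset_action_point, coset_point_eq in Hg.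
Qed.

Lemma coset_orbit_finite H L C : subgroup H -> subgroup L ->
  (forall g, virtually_contained (conj_set g L) H) ->
  finite_set (fun D => exists l, L l /\ coset_action H C l = D).
Proof.
  intros sH sL HL; destruct (coset_point_surj H C) as [g ->].
  destruct (virtually_contained_covers (conj_set g L) H) as [ts Hts];
    [now apply conj_set_subgroup|auto|].
  exists (map (fun t => coset_point H (t ** g)) ts); intros D [l [Hl <-]].
  destruct (Hts (conjg g l)) as [t [Ht Htl]]; [now apply conj_set_conjg|].
  apply in_map_iff; exists t; split; auto.
  rewrite coset_action_point; symmetry; apply coset_point_eq; auto.
  revert Htl; unfold coset, conjg; now autorewrite with group.
Qed.

Lemma fin_gen_orbit_finite H : subgroup H ->
  (forall L, fin_gen L -> ~ cofinite L -> virtually_contained L H) ->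
  forall L C, fin_gen_subgroup G mul e inv L -> ~ (exists n, index_eq G mul e inv L n) ->
  finite_set (fun D => exists l, L l /\ coset_action H C l = D).
Proof.
  intros sH absorbs L C fL iL; pose proof (proj1 fL) as sL.
  apply coset_orbit_finite; auto; intros g; apply absorbs.
  - now apply fin_gen_conj, fin_gen_subgroup_iff.
  - apply infinite_index_conj; now rewrite cofinite_iff_index_eq.
Qed.

End Groups.

Theorem theorem1p3 (G : Type) (mul : G -> G -> G) (e : G) (inv : G -> G)
  (HG : IsGroup G mul e inv)
  (Hfg : fin_gen_group G mul e inv)
  (HLERF : LERF G mul e inv)
  (Hrg : exists r, rank_gradient_is G mul e inv r /\ 0 < r) :
  exists (X : Type) (act : X -> G -> X),
    inhabited X /\
    is_right_action G mul e X act /\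
    transitive_action G X act /\
    finite_set (fun g : G => forall x : X, act x g = x) /\
    (forall L : G -> Prop,
       fin_gen_subgroup G mul e inv L ->
       ~ (exists n, index_eq G mul e inv L n) ->
       forall x : X, finite_set (fun y : X => exists l, L l /\ act x l = y)).
Proof.
  destruct Hrg as [r [Hr r_pos]]; pose proof (rank_gradient_growth HG r Hr) as growth.
  destruct Hfg as [gens Hgens]; pose proof (generated_by_list_fin_gen full gens Hgens) as fG.
  destruct (exists_absorbing_subgroup HG HLERF r r_pos growth fG)
    as [H [sH [[core_list Hcore] absorbs]]].
  exists (coset_space H), (coset_action HG H).
  split; [exact (inhabits (coset_point H e))|].
  split; [apply coset_action_is_right_action|split; [apply coset_action_transitive|split]].
  - exists core_list; intros g Hg; apply Hcore; now apply (coset_action_kernel HG).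
  - intros L fL iL C; now apply (fin_gen_orbit_finite HG).
Qed.
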